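(* Let $X$ be a set and $M(X)$ the set of multirelations over $X$. Then $(M(X),\cup,\cdot,\|,\emptyset,1_\sigma,1_\pi,d,{}^\ast)$ is a dp-bi-Kleene algebra.
   Context: A multirelation over $X$ is a subset of $X\times 2^X$. For multirelations $R,S$: $R\cdot S=\{(a,A)\mid \exists B.\,(a,B)\in R\wedge\exists f:B\to 2^X.\,(\forall b\in B.\,(b,f(b))\in S)\wedge A=\bigcup_{b\in B}f(b)\}$; $1_\sigma=\{(a,\{a\})\mid a\in X\}$; $R\|S=\{(a,A\cup B)\mid (a,A)\in R,(a,B)\in S\}$; $1_\pi=\{(a,\emptyset)\mid a\in X\}$; $d(R)=\{(a,\{a\})\mid \exists A.\,(a,A)\in R\}$; $R^\ast$ is the least fixpoint (w.r.t. $\subseteq$) of the isotone map $T\mapsto 1_\sigma\cup R\cdot T$ on $M(X)$. A dp-bi-Kleene algebra is a structure $(S,+,\cdot,\|,0,1_\sigma,1_\pi,d,{}^\ast)$ where: $+$ is associative, commutative, idempotent with unit $0$ (order $x\le y\iff x+y=y$); $1_\sigma\cdot x=x=x\cdot 1_\sigma$, $x\cdot y+x\cdot z\le x\cdot(y+z)$, $(x+y)\cdot z=x\cdot z+y\cdot z$, $0\cdot x=0$; $\|$ is associative, commutative with unit $1_\pi$, $x\|(y+z)=x\|y+x\|z$, $x\|0=0$; $x\cdot(y\cdot z)=(x\cdot y)\cdot z$ whenever one of $x,y,z$ is of the form $d(w)$; $x\le d(x)\cdot x$, $d(x\cdot y)=d(x\cdot d(y))$, $d(x+y)=d(x)+d(y)$,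 $d(x)\le 1_\sigma$, $d(0)=0$; $(x\|y)\cdot d(z)=(x\cdot d(z))\|(y\cdot d(z))$, $d(x\|y)=d(x)\cdot d(y)$, $d(x)\|d(y)=d(x)\cdot d(y)$; $1_\sigma+x\cdot x^\ast\le x^\ast$ and $d(z)+x\cdot y\le y\Rightarrow x^\ast\cdot d(z)\le y$. *)

(* Defs.v *)
From mathcomp Require Import all_boot.
From mathcomp Require Import boolp classical_sets.

Set Implicit Arguments.
Unset Strict Implicit.
Unset Printing Implicit Defensive.

Local Open Scope classical_set_scope.

Definition add_le (S : Type) (add : S -> S -> S) (x y : S) : Prop :=
  add x y = y.

Record dp_bi_kleene_algebra (S : Type) (add mul par : S -> S -> S)
    (zero one_s one_p : S) (d star : S -> S) : Prop := {
  dpA_addA : forall x y z, add x (add y z) = add (add x y) z;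
  dpA_addC : forall x y, add x y = add y x;
  dpA_addxx : forall x, add x x = x;
  dpA_add0 : forall x, add zero x = x;

  dpA_mul1l : forall x, mul one_s x = x;
  dpA_mul1r : forall x, mul x one_s = x;
  dpA_mulDr_sub : forall x y z,
    add_le add (add (mul x y) (mul x z)) (mul x (add y z));
  dpA_mulDl : forall x y z, mul (add x y) z = add (mul x z) (mul y z);
  dpA_mul0l : forall x, mul zero x = zero;

  dpA_parA : forall x y z, par x (par y z) = par (par x y) z;
  dpA_parC : forall x y, par x y = par y x;
  dpA_par1 : forall x, par one_p x = x;
  dpA_parDr : forall x y z, par x (add y z) = add (par x y) (par x z);
  dpA_par0 : forall x, par x zero = zero;

  dpA_mulA_dom : forall x y z,
    (exists w, x = d w \/ y = d w \/ z = d w) ->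
    mul x (mul y z) = mul (mul x y) z;

  dpA_dom_le : forall x, add_le add x (mul (d x) x);
  dpA_dom_local : forall x y, d (mul x y) = d (mul x (d y));
  dpA_domD : forall x y, d (add x y) = add (d x) (d y);
  dpA_dom_le1 : forall x, add_le add (d x) one_s;
  dpA_dom0 : d zero = zero;

  dpA_par_mul_dom : forall x y z,
    mul (par x y) (d z) = par (mul x (d z)) (mul y (d z));
  dpA_dom_par : forall x y, d (par x y) = mul (d x) (d y);
  dpA_par_dom : forall x y, par (d x) (d y) = mul (d x) (d y);

  dpA_star_unfold : forall x,
    add_le add (add one_s (mul x (star x))) (star x);
  dpA_star_ind : forall x y z,
    add_le add (add (d z) (mul x y)) y -> add_le add (mul (star x) (d z)) y
}.

Definition is_least_fixpoint (T : Type) (F : set T -> set T) (A : set T) : Prop :=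
  F A = A /\ forall B, F B = B -> A `<=` B.

Definition least_fixpoint (T : Type) (F : set T -> set T) : set T :=
  xget set0 [set A | is_least_fixpoint F A].

Section Multirelations.
Variable X : Type.

Definition multirel : Type := set (X * set X).
Implicit Types R S T : multirel.

Definition mr_union R S : multirel := R `|` S.

Definition mr_empty : multirel := set0.

(* The choice functions f : B -> 2^X are given as total functions X -> 2^X of
   which only the values on B matter. *)
Definition mr_seq R S : multirel :=
  [set p | exists B : set X, R (p.1, B) /\
           exists f : X -> set X,
             (forall b, B b -> S (b, f b)) /\ p.2 = \bigcup_(b in B) f b].

Definition mr_one_s : multirel := [set p | p.2 = [set p.1]].

Definition mr_par R S : multirel :=
  [set p | exists A B : set X, R (p.1, A) /\ S (p.1, B) /\ p.2 = A `|` B].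

Definition mr_one_p : multirel := [set p | p.2 = set0].

Definition mr_dom R : multirel :=
  [set p | p.2 = [set p.1] /\ exists A : set X, R (p.1, A)].

Definition mr_star_step R : multirel -> multirel :=
  fun T => mr_union mr_one_s (mr_seq R T).

Definition mr_star R : multirel := least_fixpoint (mr_star_step R).

End Multirelations.

Arguments mr_one_s {X}.
Arguments mr_one_p {X}.
Arguments mr_empty {X}.

(* Knaster-Tarski: the default value of [xget] is not used for isotone maps. *)
Lemma least_fixpointP (T : Type) (F : set T -> set T) :
  (forall A B, A `<=` B -> F A `<=` F B) ->
  is_least_fixpoint F (least_fixpoint F).
Proof.
move=> Fm; apply: xgetPex.
pose L := \bigcap_(A in [set A | F A `<=` A]) A.
have FL : F L `<=` L.
  by move=> x FLx A /= FA; apply: (FA); apply: Fm FLx => y Ly; exact: Ly.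
exists L; split; last by move=> B FB x; apply; rewrite /= FB.
apply/seteqP; split=> // x; apply; exact: Fm.
Qed.

Lemma mr_star_lfp (X : Type) (R : multirel X) :
  is_least_fixpoint (mr_star_step R) (mr_star R).
Proof.
apply: least_fixpointP => A B AB [a C] [?|]; first by left.
move=> [D [RD [f [fA Cf]]]]; right; exists D; split=> //.
by exists f; split=> // b /fA /AB.
Qed.

(* Main.v *)
(** Write [test D] for the part of [1_sigma] over a set [D]. The elements of the
    form [d(R)] are exactly the tests, [d(R)] being the test of the support of
    [R]. Composing with a test only restricts a multirelation: [test D . R]
    keeps the pairs [(a, A)] of [R] with [a] in [D], and [R . test D] those with
    [A] included in [D]; all the laws on [d] but star induction compare such
    restrictions or compute supports. As [R . test D] is an intersection,
    [R |-> R . test D] has an upper adjoint, the residual [S |-> S / D]. Star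
    induction thus amounts to [R^*] being included in [S / D], and [S / D] is a
    prefixed point of the map defining [R^*] as soon as
    [test D + R . S <= S]. *)
From mathcomp Require Import all_boot.
From mathcomp Require Import boolp classical_sets.
Require Import Defs.

Set Implicit Arguments.
Unset Strict Implicit.
Unset Printing Implicit Defensive.

Local Open Scope classical_set_scope.

Lemma least_fixpoint_ind (T : Type) (F : set T -> set T) (B : set T) :
  {homo F : C D / C `<=` D} -> F B `<=` B -> least_fixpoint F `<=` B.
Proof.
move=> F_homo FB.
(* A fixpoint of [C |-> F (C `&` B)] lies in [B], hence is a fixpoint of [F]. *)
pose M := least_fixpoint (fun C => F (C `&` B)).
have [ME _] : is_least_fixpoint (fun C => F (C `&` B)) M.
  by apply: least_fixpointP => C D CD; apply: F_homo; exact: setSI.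
have MB : M `<=` B.
  by rewrite -ME; apply: subset_trans FB; apply: F_homo; exact: subIsetr.
apply: (subset_trans _ MB); apply: (least_fixpointP F_homo).2.
by rewrite -[in RHS]ME (setIidl MB).
Qed.

Section MultirelationLaws.
Variable X : Type.
Implicit Types (R S T : multirel X) (D E : set X).

Lemma add_le_mr_unionP R S : add_le (@mr_union X) R S <-> R `<=` S.
Proof. by split=> /setUidPr. Qed.

Lemma mr_seqS R : {homo mr_seq R : S T / S `<=` T}.
Proof.
move=> S T ST p [B [RB [f [fS pE]]]]; exists B; split=> //.
by exists f; split=> // b /fS /ST.
Qed.

Lemma mr_seqUr_sub R S T :
  mr_union (mr_seq R S) (mr_seq R T) `<=` mr_seq R (mr_union S T).
Proof.
by rewrite subUset; split; apply: mr_seqS; [exact: subsetUl|exact: subsetUr].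
Qed.

Lemma mr_seqUl R S T :
  mr_seq (mr_union R S) T = mr_union (mr_seq R T) (mr_seq S T).
Proof.
apply/seteqP; split=> [p [B [[RB|SB] fT]]|p [[B [RB fT]]|[B [SB fT]]]].
- by left; exists B.
- by right; exists B.
- by exists B; split=> //; left.
- by exists B; split=> //; right.
Qed.

Lemma mr_seq0l R : mr_seq mr_empty R = mr_empty.
Proof. by apply/seteqP; split=> // p [B []]. Qed.

Lemma mr_parA R S T : mr_par R (mr_par S T) = mr_par (mr_par R S) T.
Proof.
apply/seteqP; split=> -[a D].
- move=> [A [E [RA [[B [C [/= SB [/= TC ->]]]] /= ->]]]].
  by exists (A `|` B), C; rewrite setUA; split; first by exists A, B.
- move=> [E [C [[A [B [/= RA [/= SB ->]]]] [TC /= ->]]]].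
  by exists A, (B `|` C); rewrite setUA; split=> //; split=> //; exists B, C.
Qed.

Lemma mr_parC R S : mr_par R S = mr_par S R.
Proof.
by apply/seteqP; split=> p [A [B [RA [SB pE]]]]; exists B, A; rewrite setUC.
Qed.

Lemma mr_par1l R : mr_par mr_one_p R = R.
Proof.
apply/seteqP; split=> -[a A].
  by move=> [E [B [E0 [RB /= ->]]]]; rewrite (E0 : E = set0) set0U.
by move=> RA; exists set0, A; rewrite set0U.
Qed.

Lemma mr_parUr R S T :
  mr_par R (mr_union S T) = mr_union (mr_par R S) (mr_par R T).
Proof.
apply/seteqP; split=> [p [A [B [RA [[SB|TB] pE]]]]|p].
- by left; exists A, B.
- by right; exists A, B.
- move=> [[A [B [RA [SB pE]]]]|[A [B [RA [TB pE]]]]]; exists A, B.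
    by split=> //; split=> //; left.
  by split=> //; split=> //; right.
Qed.

Lemma mr_par0r R : mr_par R mr_empty = mr_empty.
Proof. by apply/seteqP; split=> // p [A [B [_ []]]]. Qed.

Definition mr_test D : multirel X := [set p | p.2 = [set p.1] /\ D p.1].

Lemma mr_testT : mr_test setT = mr_one_s.
Proof. exact: setIT. Qed.

Lemma mr_testU D E : mr_test (D `|` E) = mr_union (mr_test D) (mr_test E).
Proof. exact: setIUr. Qed.

Lemma mr_seq_testl D R : mr_seq (mr_test D) R = R `&` fst @^-1` D.
Proof.
apply/seteqP; split=> -[a A].
  move=> [B [[/= -> Da] [f [fR /= ->]]]].
  by rewrite bigcup_set1; split=> //; exact: fR.
move=> [RA Da]; exists [set a]; split=> //; exists (fun=> A).
by split=> [_ ->|]; rewrite /= ?bigcup_set1.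
Qed.

Lemma mr_seq_testr R D :
  mr_seq R (mr_test D) = R `&` [set p | p.2 `<=` D].
Proof.
apply/seteqP; split=> -[a A].
  move=> [B [RB [f [fD /= ->]]]].
  have -> : \bigcup_(b in B) f b = B.
    rewrite -[RHS]image_id -bigcup_imset1.
    by apply: eq_bigcupr => b /fD[].
  by split=> // b /fD[].
move=> [RA AD]; exists A; split=> //; exists set1; split=> [b /AD //|].
by rewrite /= bigcup_imset1 image_id.
Qed.

Lemma mr_seq_test D E : mr_seq (mr_test D) (mr_test E) = mr_test (D `&` E).
Proof.
rewrite mr_seq_testl; apply/seteqP.
by split=> [p [[pE Ep] Dp]|p [pE [Dp Ep]]].
Qed.

Lemma mr_par_test D E : mr_par (mr_test D) (mr_test E) = mr_test (D `&` E).
Proof.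
apply/seteqP; split=> -[a C].
  by move=> [A [B [[/= -> Da] [[/= -> Ea] /= ->]]]]; rewrite setUid.
move=> [/= -> [Da Ea]].
by exists [set a], [set a]; rewrite setUid.
Qed.

Lemma mr_seq1l R : mr_seq mr_one_s R = R.
Proof. by rewrite -mr_testT mr_seq_testl; exact: setIT. Qed.

Lemma mr_seq1r R : mr_seq R mr_one_s = R.
Proof. by rewrite -mr_testT mr_seq_testr; apply: setIidl => p _. Qed.

Lemma mr_seqA_testl D R S :
  mr_seq (mr_test D) (mr_seq R S) = mr_seq (mr_seq (mr_test D) R) S.
Proof.
rewrite !mr_seq_testl; apply/seteqP.
split=> [p [[B [RB fS]] Dp]|p [B [[RB Dp] fS]]]; first by exists B.
by split=> //; exists B.
Qed.

Lemma mr_seqA_testm R D S :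
  mr_seq R (mr_seq (mr_test D) S) = mr_seq (mr_seq R (mr_test D)) S.
Proof.
rewrite mr_seq_testl mr_seq_testr; apply/seteqP; split=> p.
  move=> [B [RB [f [fDS pE]]]].
  by exists B; split; [|exists f]; split=> // b /fDS[].
move=> [B [[RB BD] [f [fS pE]]]]; exists B; split=> //.
by exists f; split=> // b Bb; split; [exact: fS|exact: BD].
Qed.

Lemma mr_seqA_testr R S D :
  mr_seq R (mr_seq S (mr_test D)) = mr_seq (mr_seq R S) (mr_test D).
Proof.
rewrite !mr_seq_testr; apply/seteqP; split=> -[a A].
  move=> [B [RB [f [fSD /= ->]]]]; split.
    by exists B; split=> //; exists f; split=> // b /fSD[].
  by apply: bigcup_sub => b /fSD[].
move=> [[B [RB [f [fS /= ->]]]] /= fBD]; exists B; split=> //.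
exists f; split=> // b Bb; split; first exact: fS.
exact: subset_trans (bigcup_sup Bb) fBD.
Qed.

Lemma mr_seq_par_test R S D :
  mr_seq (mr_par R S) (mr_test D) =
  mr_par (mr_seq R (mr_test D)) (mr_seq S (mr_test D)).
Proof.
rewrite !mr_seq_testr; apply/seteqP; split=> -[a C].
  move=> [[A [B [RA [SB /= ->]]]]]; rewrite /= subUset => -[AD BD].
  by exists A, B.
move=> [A [B [[RA /= AD] [[SB /= BD] /= ->]]]].
by split; [exists A, B|rewrite /= subUset].
Qed.

Definition mr_support R : set X := [set a | exists A, R (a, A)].

Lemma mr_support_test D : mr_support (mr_test D) = D.
Proof. by apply/seteqP; split=> [a [A []] //|a Da]; exists [set a]. Qed.

Lemma mr_support0 : mr_support mr_empty = set0.
Proof. by apply/seteqP; split=> // a []. Qed.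

Lemma mr_supportU R S :
  mr_support (mr_union R S) = mr_support R `|` mr_support S.
Proof.
apply/seteqP; split=> [a [A [RA|SA]]|a [[A RA]|[A SA]]].
- by left; exists A.
- by right; exists A.
- by exists A; left.
- by exists A; right.
Qed.

Lemma mr_support_seq R S :
  mr_support (mr_seq R S) =
  [set a | exists2 B, R (a, B) & B `<=` mr_support S].
Proof.
apply/seteqP; split=> a [].
  by move=> A [B [RB [f [fS _]]]]; exists B => // b /fS; exists (f b).
move=> B RB BS.
have /choice[f fS] : forall b, exists C, B b -> S (b, C).
  move=> b; have [/BS[C SC]|nB] := pselect (B b); first by exists C.
  by exists set0.
by exists (\bigcup_(b in B) f b), B; split=> //; exists f.
Qed.

Lemma mr_support_par R S :
  mr_support (mr_par R S) = mr_support R `&` mr_support S.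
Proof.
apply/seteqP; split=> [a [C [A [B [RA [SB _]]]]]|a [[A RA] [B SB]]].
  by split; [exists A|exists B].
by exists (A `|` B), A, B.
Qed.

Lemma mr_domE R : mr_dom R = mr_test (mr_support R).
Proof. by []. Qed.

Lemma mr_seqA_dom R S T :
  (exists Q, R = mr_dom Q \/ S = mr_dom Q \/ T = mr_dom Q) ->
  mr_seq R (mr_seq S T) = mr_seq (mr_seq R S) T.
Proof.
by move=> [Q [->|[->|->]]]; rewrite mr_domE;
  [exact: mr_seqA_testl|exact: mr_seqA_testm|exact: mr_seqA_testr].
Qed.

Lemma mr_dom_sub1 R : mr_dom R `<=` mr_one_s.
Proof. exact: subIsetl. Qed.

Lemma sub_mr_dom_seq R : R `<=` mr_seq (mr_dom R) R.
Proof. by rewrite mr_domE mr_seq_testl => -[a A] RA; split=> //; exists A. Qed.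

Lemma mr_dom_seq R S : mr_dom (mr_seq R S) = mr_dom (mr_seq R (mr_dom S)).
Proof. by rewrite !mr_domE !mr_support_seq mr_support_test. Qed.

Lemma mr_domU R S : mr_dom (mr_union R S) = mr_union (mr_dom R) (mr_dom S).
Proof. by rewrite !mr_domE mr_supportU mr_testU. Qed.

Lemma mr_dom0 : mr_dom mr_empty = mr_empty :> multirel X.
Proof. by rewrite mr_domE mr_support0; exact: setI0. Qed.

Lemma mr_dom_par R S : mr_dom (mr_par R S) = mr_seq (mr_dom R) (mr_dom S).
Proof. by rewrite !mr_domE mr_seq_test mr_support_par. Qed.

Lemma mr_par_dom R S :
  mr_par (mr_dom R) (mr_dom S) = mr_seq (mr_dom R) (mr_dom S).
Proof. by rewrite !mr_domE mr_par_test mr_seq_test. Qed.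

Lemma mr_starE R : mr_union mr_one_s (mr_seq R (mr_star R)) = mr_star R.
Proof. exact: (mr_star_lfp R).1. Qed.

Definition mr_residual S D : multirel X := [set p | p.2 `<=` D -> S p].

Lemma mr_seq_test_subP R S D :
  mr_seq R (mr_test D) `<=` S <-> R `<=` mr_residual S D.
Proof.
by rewrite mr_seq_testr; split=> [RS p Rp pD|RS p [/RS]]; [exact: RS|exact].
Qed.

Lemma mr_star_ind R S D :
  mr_union (mr_test D) (mr_seq R S) `<=` S ->
  mr_seq (mr_star R) (mr_test D) `<=` S.
Proof.
rewrite subUset => -[DS RS]; apply/mr_seq_test_subP.
apply: least_fixpoint_ind => [T T' TT'|]; first exact/setUS/mr_seqS.
apply/mr_seq_test_subP.
rewrite mr_seqUl mr_seq1l -mr_seqA_testr subUset; split=> //.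
by apply: subset_trans RS; apply: mr_seqS; exact/mr_seq_test_subP.
Qed.

End MultirelationLaws.

Theorem theorem10p8 (X : Type) :
  @dp_bi_kleene_algebra (multirel X)
    (@mr_union X) (@mr_seq X) (@mr_par X)
    (@mr_empty X) (@mr_one_s X) (@mr_one_p X)
    (@mr_dom X) (@mr_star X).
Proof.
have add_leP := @add_le_mr_unionP X.
split;
  [ exact: setUA | exact: setUC | exact: setUid | exact: set0U
  | exact: mr_seq1l | exact: mr_seq1r
  | by move=> *; exact/add_leP/mr_seqUr_sub | exact: mr_seqUl | exact: mr_seq0l
  | exact: mr_parA | exact: mr_parC | exact: mr_par1l
  | exact: mr_parUr | exact: mr_par0r
  | exact: mr_seqA_dom
  | by move=> *; exact/add_leP/sub_mr_dom_seq
  | exact: mr_dom_seq | exact: mr_domU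
  | by move=> *; exact/add_leP/mr_dom_sub1 | exact: mr_dom0
  | by move=> R S T; rewrite mr_domE mr_seq_par_test
  | exact: mr_dom_par | exact: mr_par_dom
  | by move=> R; apply/add_leP; rewrite mr_starE
  | by move=> R S T; rewrite mr_domE => /add_leP/mr_star_ind/add_leP ].
Qed.
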